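(* For every $c \in (0,1)$ and every $\rhd \in \{\ge, >\}$, threshold Büchi objectives and threshold co-Büchi objectives with threshold $\rhd c$ are not strongly determined in general, even for finitely branching games. That is: for every $c\in(0,1)$ and $\rhd\in\{\ge,>\}$ there exist a finitely branching stochastic game $\mathcal{G}$ with countable state space $S$ and a set $\mathcal{T} \subseteq S$ such that the threshold objective $(\mathtt{B\ddot uchi}(\mathcal{T}), \rhd c)$ is not strongly determined in $\mathcal{G}$; and likewise there exist a finitely branching stochastic game $\mathcal{G}$ with countable state space $S$ and a set $\mathcal{T} \subseteq S$ such that $(\neg\mathtt{B\ddot uchi}(\mathcal{T}), \rhd c)$ is not strongly determined in $\mathcal{G}$.
   Context: A (2-player turn-based stochastic) game is $\mathcal{G} = (S,(S_\Box,S_\Diamond,S_\bigcirc),\longrightarrow,P)$, where $S$ is a countable set of states partitioned into the states $S_\Box$ of player $\Box$ (maximizer), the states $S_\Diamond$ of player $\Diamond$ (minimizer) and the random states $S_\bigcirc$; $\longrightarrow\, \subseteq S\times S$ is the transition relation, such that every state has at least one successor ($s'$ is a successor of $s$ if $s \longrightarrow s'$); and $P$ assigns to each $s \in S_\bigcirc$ a probability distribution over its successors. The game is finitely branching if each state has only finitely many successors. A strategy of player $\Box$ is a function $\sigma$ assigning to each finite sequence $ws \in S^*S_\Box$ a probability distribution over the successors of $s$; strategies $\pi$ of player $\Diamond$ are defined analogously on $S^*S_\Diamond$. (Strategies may be history-dependent and randomized.) Given an initial state $s_0$ and strategies $\sigma,\pi$, $\mathcal{P}_{\mathcal{G},s_0,\sigma,\pi}$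 is the unique probability measure on the Borel $\sigma$-algebra of $s_0S^\omega$ (generated by cylinder sets) with $\mathcal{P}_{\mathcal{G},s_0,\sigma,\pi}(s_0 s_1\cdots s_n S^\omega) = \prod_{i=0}^{n-1} \tau(s_0\cdots s_i)(s_{i+1})$, where $\tau(ws)$ equals $\sigma(ws)$, $\pi(ws)$ or $P(s)$ according to whether $s \in S_\Box$, $S_\Diamond$ or $S_\bigcirc$. For $\mathcal{E} \subseteq S^\omega$, $\mathcal{P}_{\mathcal{G},s_0,\sigma,\pi}(\mathcal{E})$ means $\mathcal{P}_{\mathcal{G},s_0,\sigma,\pi}(\mathcal{E}\cap s_0S^\omega)$. For $\mathcal{T}\subseteq S$, the Büchi objective is $\mathtt{B\ddot uchi}(\mathcal{T}) = \{s_0s_1\cdots \in S^\omega \mid \forall i\,\exists j \ge i.\ s_j \in \mathcal{T}\}$, and the co-Büchi objective is its complement $\neg\mathtt{B\ddot uchi}(\mathcal{T}) = S^\omega \setminus \mathtt{B\ddot uchi}(\mathcal{T})$. A threshold objective $(\mathcal{E}, \rhd c)$ is strongly determined in $\mathcal{G}$ iff for every state $s \in S$ either there is a player $\Box$ strategy $\sigma$ such that $\mathcal{P}_{\mathcal{G},s,\sigma,\pi}(\mathcal{E}) \rhd c$ for all player $\Diamond$ strategies $\pi$, or there is a player $\Diamond$ strategy $\pi$ such that for all player $\Box$ strategies $\sigma$ it is not the case that $\mathcal{P}_{\mathcal{G},s,\sigma,\pi}(\mathcal{E}) \rhd c$. *)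

(* Defs.v *)
From HB Require Import structures.
From mathcomp Require Import all_boot all_order all_algebra.
From mathcomp Require Import all_classical all_reals all_analysis.

Set Implicit Arguments.
Unset Strict Implicit.
Unset Printing Implicit Defensive.

Import Order.TTheory GRing.Theory Num.Theory.

Local Open Scope classical_set_scope.
Local Open Scope ring_scope.

Definition is_distr (R : realType) (T : choiceType) (A : set T) (f : T -> R) :=
  [/\ forall t, 0 <= f t, forall t, ~ A t -> f t = 0
    & \esum_(t in A) (f t)%:E = 1%E].

(* [Box] is the maximizer, [Diamond] the minimizer. *)
Inductive kind := Box | Diamond | Random.

(* [succ s] is the set of successors of [s]; [kind_of] encodes the partition of
   the states.  The values of [prob] at non-random states are irrelevant. *)
Record game (R : realType) := Game {
  state :> countType;
  kind_of : state -> kind;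
  succ : state -> set state;
  prob : state -> state -> R;
  succ_neq0 : forall s, succ s !=set0;
  prob_distr : forall s, kind_of s = Random -> is_distr (succ s) (prob s) }.

Definition finitely_branching (R : realType) (G : game R) :=
  forall s : G, finite_set (succ s).

(* [strat w s] is the distribution chosen after the finite sequence [ws], where
   [w] need not be a path of the game; only its values at states [s] of kind [k]
   are relevant. *)
Record strategy (R : realType) (G : game R) (k : kind) := Strategy {
  strat :> seq G -> G -> G -> R;
  strat_distr : forall (w : seq G) (s : G),
    kind_of s = k -> is_distr (succ s) (strat w s) }.

Definition step (R : realType) (G : game R) (sigma : strategy G Box)
    (pi : strategy G Diamond) (w : seq G) (s : G) : G -> R :=
  match kind_of s with
  | Box => sigma w s
  | Diamond => pi w s
  | Random => prob s
  end.

(* Infinite sequences of states.  The initial state only serves to make the type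
   pointed, as the library requires of measurable types. *)
Definition run (R : realType) (G : game R) (s0 : G) : Type := nat -> G.

HB.instance Definition _ (R : realType) (G : game R) (s0 : G) :=
  Choice.copy (run s0) (nat -> G).
HB.instance Definition _ (R : realType) (G : game R) (s0 : G) :=
  isPointed.Build (run s0) (fun _ => s0).

(* The set r_0 r_1 ... r_n S^omega. *)
Definition cylinder (R : realType) (G : game R) (r : nat -> G) (n : nat) :
    set (nat -> G) :=
  [set r' | forall i, (i <= n)%N -> r' i = r i].

Definition cylinders (R : realType) (G : game R) (s0 : G) : set (set (run s0)) :=
  [set C | exists (r : nat -> G) (n : nat), C = cylinder r n].

Definition borel_run (R : realType) (G : game R) (s0 : G) :=
  g_sigma_algebraType (@cylinders R G s0).

(* Every finite sequence s_0 ... s_n is the prefix of length n + 1 of some [r],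
   so that the equation is required of all cylinders included in s_0 S^omega;
   [mkseq r i] is r_0 ... r_(i-1). *)
Definition is_game_measure (R : realType) (G : game R) (s0 : G)
    (sigma : strategy G Box) (pi : strategy G Diamond)
    (mu : probability (borel_run s0) R) : Prop :=
  forall (r : nat -> G) (n : nat), r 0%N = s0 ->
    mu (cylinder r n) =
      (\prod_(i < n) step sigma pi (mkseq r i) (r i) (r i.+1))%:E.

(* The unique measure satisfying [is_game_measure], extended to all of S^omega by
   0 outside of s_0 S^omega.  The Dirac measure is an unused default value, since
   existence holds by the Ionescu-Tulcea theorem. *)
Definition game_measure (R : realType) (G : game R) (s0 : G)
    (sigma : strategy G Box) (pi : strategy G Diamond) :
    probability (borel_run s0) R :=
  xget (dirac (point : borel_run s0) : probability (borel_run s0) R)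
    [set mu | is_game_measure sigma pi mu].

Definition game_prob (R : realType) (G : game R) (s0 : G)
    (sigma : strategy G Box) (pi : strategy G Diamond) (E : set (nat -> G)) :
    \bar R :=
  game_measure s0 sigma pi (E `&` [set r | r 0%N = s0]).

Definition buchi (R : realType) (G : game R) (T : set G) : set (nat -> G) :=
  [set r | forall i, exists2 j, (i <= j)%N & T (r j)].

Definition cobuchi (R : realType) (G : game R) (T : set G) : set (nat -> G) :=
  ~` buchi T.

Inductive comparison := AtLeast | MoreThan.

Definition threshold (R : realType) (rhd : comparison) (x : \bar R) (c : R) :
    Prop :=
  match rhd with
  | AtLeast => (c%:E <= x)%E
  | MoreThan => (c%:E < x)%E
  end.

Definition strongly_determined (R : realType) (G : game R)
    (E : set (nat -> G)) (rhd : comparison) (c : R) : Prop :=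
  forall s : G,
    (exists sigma : strategy G Box, forall pi : strategy G Diamond,
       threshold rhd (game_prob s sigma pi E) c) \/
    (exists pi : strategy G Diamond, forall sigma : strategy G Box,
       ~ threshold rhd (game_prob s sigma pi E) c).

(* Main.v *)
Require Import Defs.
From HB Require Import structures.
From mathcomp Require Import all_boot all_order all_algebra.
From mathcomp Require Import all_classical all_reals all_analysis.
From mathcomp Require Import ring lra zify.

(* A fair coin sends the play either to a chain of the maximizer or to a chain
   of the minimizer.  On his chain a player must choose when to leave: staying
   forever loses, and leaving at position n wins with probability
   s (1 - 1/(n+1)), where s = c for the maximizer and s = 1 - c for the
   minimizer.  So both players want to leave as late as possible, the supremum s
   is not attained, and the value of the game is c/2 + (1 - (1 - c))/2 = c.
   Any fixed strategy loses some delta > 0 on its own chain, and an opponent who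
   leaves his own chain late enough loses less than delta: every maximizer
   strategy is beaten strictly below c and every minimizer strategy strictly
   above c, which refutes determinacy for >= c and > c alike.

   Almost every play that does not stay on a chain ends in a sink, so the same
   game serves for Buchi and co-Buchi objectives.

   Evaluating [game_measure] requires the existence of the measure of a play.
   As every state has at most two successors, the play is read off a uniform
   point of [0, 1[ by successively splitting an interval in two. *)

Set Implicit Arguments.
Unset Strict Implicit.
Unset Printing Implicit Defensive.

Import Order.TTheory GRing.Theory Num.Theory.

Local Open Scope classical_set_scope.
Local Open Scope ring_scope.

(** * Distributions on two possibly equal points *)

Lemma is_distr_set2 (R : realType) (T : choiceType) (a b : T) (f : T -> R) :
  is_distr [set a; b] f <->
  [/\ forall t, 0 <= f t, forall t, t != a -> t != b -> f t = 0
    & f a + (if a == b then 0 else f b) = 1].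
Proof.
have sumE : (forall t, 0 <= f t) ->
    \esum_(t in [set a; b]) (f t)%:E = (f a + (if a == b then 0 else f b))%:E.
  move=> f0; case: eqVneq => [<-|ab].
    by rewrite setUid addr0 esum_set1 ?lee_fin.
  rewrite (esumID [set a]) => [|t _]; last by rewrite lee_fin.
  rewrite setIUl setIid [X in _ `|` X](_ : _ = set0); last first.
    by apply/seteqP; split=> // t [/= -> ba]; rewrite ba eqxx in ab.
  rewrite setU0 [X in _ + \esum_(t in X) _](_ : _ = [set b])%E; last first.
    apply/seteqP; split=> [t [[->//|->//]]|t ->] /=; first by [].
    by split; [right|apply/eqP; rewrite eq_sym].
  by rewrite !esum_set1 ?lee_fin// EFinD.
split=> [[f0 fA]|[f0 fA f1]].
  rewrite sumE// => -[f1]; split=> // t ta tb; apply: fA => -[] E.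
    by rewrite E eqxx in ta.
  by rewrite E eqxx in tb.
split=> //; last by rewrite sumE// f1.
move=> t tab; apply: fA; apply/eqP => E; apply: tab.
  by left.
by right.
Qed.

(** * The uniform distribution on the unit interval *)

Section uniform_measure.
Context (R : realType).
Let mD : measurable (`[0, 1[%classic : set (measurableTypeR R)).
Proof. exact: measurable_itv. Qed.

Definition unif01 : set (measurableTypeR R) -> \bar R :=
  mrestr lebesgue_measure mD.

HB.instance Definition _ := Measure.on unif01.

Let unif01_setT : unif01 [set: _] = 1%E.
Proof.
by rewrite /unif01 /mrestr setTI lebesgue_measure_itv/= lte_fin ltr01 oppr0
  adde0.
Qed.

HB.instance Definition _ :=
  Measure_isProbability.Build _ _ _ unif01 unif01_setT.
End uniform_measure.

(** * Existence of the measure of a play under binary branching *)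

Section binary_game.
Context (R : realType) (G : game R) (lft rgt : G -> G).
Hypothesis succE : forall s : G, succ s = [set lft s; rgt s].
Context (s0 : G) (tau : seq G -> G -> G -> R).
Hypothesis tauP : forall w s, is_distr (succ s) (tau w s).

Let tau_ge0 w s t : 0 <= tau w s t.
Proof. by have [] := tauP w s. Qed.

Let tau_eq0 w s t : t != lft s -> t != rgt s -> tau w s t = 0.
Proof. by move: (tauP w s); rewrite succE => /is_distr_set2[_ + _]; exact. Qed.

Let tau_sum w s : tau w s (lft s) + (if lft s == rgt s then 0
  else tau w s (rgt s)) = 1.
Proof. by move: (tauP w s); rewrite succE => /is_distr_set2[]. Qed.

(** Prefixes are coded by nested intervals: the one ending in [r n] gets length [weight r n] and
    left end [low r n]; its left part goes to [lft (r n)], the remainder to [rgt (r n)]. *)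
Let weight (r : nat -> G) n := \prod_(i < n) tau (mkseq r i) (r i) (r i.+1).

Let low (r : nat -> G) n := \sum_(i < n) (if r i.+1 == lft (r i) then 0
  else weight r i * tau (mkseq r i) (r i) (lft (r i))).

Let weightS r n :
  weight r n.+1 = weight r n * tau (mkseq r n) (r n) (r n.+1).
Proof. by rewrite /weight big_ord_recr. Qed.

Let lowS r n : low r n.+1 = low r n + (if r n.+1 == lft (r n) then 0
  else weight r n * tau (mkseq r n) (r n) (lft (r n))).
Proof. by rewrite /low big_ord_recr. Qed.

Let weight_ge0 r n : 0 <= weight r n.
Proof. by apply: prodr_ge0 => i _. Qed.

Let interval_subset r n : low r n <= low r n.+1 /\
  low r n.+1 + weight r n.+1 <= low r n + weight r n.
Proof.
have w0 := weight_ge0 r n; rewrite lowS weightS.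
have := tau_sum (mkseq r n) (r n).
have := tau_ge0 (mkseq r n) (r n) (lft (r n)).
have := tau_ge0 (mkseq r n) (r n) (rgt (r n)).
have := @tau_eq0 (mkseq r n) (r n) (r n.+1).
case: (eqVneq (r n.+1) (lft (r n))) => [->|nl].
  by move=> _; case: ifP => _; nra.
case: (eqVneq (r n.+1) (rgt (r n))) => [e|nr].
  by rewrite e eq_sym in nl; rewrite e (negbTE nl); nra.
by move=> /(_ isT isT) ->; case: ifP => _; nra.
Qed.

Let interval_bounds r n : 0 <= low r n /\ low r n + weight r n <= 1.
Proof.
elim: n => [|n [IH0 IH1]]; first by rewrite /low /weight !big_ord0 add0r.
have [h1 h2] := interval_subset r n.
by split; [exact: le_trans h1|exact: le_trans IH1].
Qed.

Let weight_low_ext r r' n : (forall i, (i <= n)%N -> r i = r' i) ->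
  weight r n = weight r' n /\ low r n = low r' n.
Proof.
move=> rr'.
have wE m : (m <= n)%N -> weight r m = weight r' m.
  move=> mn; apply: eq_bigr => -[i im] _ /=.
  rewrite !rr' ?(leq_trans im)// 1?ltnW ?(leq_trans im)//.
  congr tau; apply/eq_in_map => k; rewrite mem_iota add0n => /andP[_ ki].
  by rewrite rr'// ltnW// (ltn_trans ki)// (leq_trans im).
split; first exact: wE.
apply: eq_bigr => -[i im] _ /=.
rewrite !rr' ?(ltnW im)// wE 1?ltnW//; congr (if _ then _ else _ * tau _ _ _).
apply/eq_in_map => k; rewrite mem_iota add0n => /andP[_ ki].
by rewrite rr'// ltnW// (ltn_trans ki).
Qed.

(** For [x] in [0, 1[, the components are the history, the current state, and the left end and
    length of the interval that still contains [x]. *)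
Let play (x : R) := fix play n : seq G * G * R * R :=
  if n is m.+1 then
    let: (w, s, l, v) := play m in
    let p := v * tau w s (lft s) in
    if x < l + p then (rcons w s, lft s, l, p)
    else (rcons w s, rgt s, l + p, v * tau w s (rgt s))
  else ([::], s0, 0, 1).

Let run_of x n : G := (play x n).1.1.2.

Let playE (x : R) n : 0 <= x < 1 ->
  let r := run_of x in
  play x n = (mkseq r n, r n, low r n, weight r n) /\
  low r n <= x < low r n + weight r n.
Proof.
move=> x01 r; elim: n => [|n [IH xI]].
  by rewrite /r /run_of /low /weight !big_ord0 /= add0r.
have rE : r n.+1 =
    if x < low r n + weight r n * tau (mkseq r n) (r n) (lft (r n))
    then lft (r n) else rgt (r n).
  by rewrite {1}/r /run_of /= IH; case: ifP.
have := tau_sum (mkseq r n) (r n).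
rewrite /= IH lowS weightS mkseqS rE.
set t := tau _ _ (lft _) in rE *; case: (ltP x _) => [h|h] tE.
  by rewrite eqxx addr0 (andP xI).1 h.
case: eqVneq tE => [e|ne] tE.
  (* If both successors coincide, the left part is the whole interval, so [x] cannot lie beyond
     it. *)
  exfalso; move: h xI; rewrite (_ : t = 1) ?mulr1 => [|]; last by lra.
  by move=> h /andP[_]; rewrite ltNge h.
split=> //; rewrite h /=.
by rewrite -addrA -mulrDr tE mulr1 (andP xI).2.
Qed.

Let run_cylinder (x : R) r n : 0 <= x < 1 -> r 0%N = s0 ->
  cylinder r n (run_of x) <-> low r n <= x < low r n + weight r n.
Proof.
move=> x01 r0; split=> [/weight_low_ext[<- <-]|].
  by have [] := playE n x01.
elim: n => [|n IH] xI; first by move=> i; rewrite leqn0 => /eqP->; rewrite r0.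
have {}IH : cylinder r n (run_of x).
  by apply: IH; have [h1 h2] := interval_subset r n; lra.
move=> i; rewrite leq_eqVlt => /predU1P[->|]; last by rewrite ltnS; exact: IH.
have [pE _] := playE n x01; have [wE lE] := weight_low_ext IH.
have mE : mkseq (run_of x) n = mkseq r n.
  apply/eq_in_map => k; rewrite mem_iota add0n => /andP[_ ki].
  by apply: IH; rewrite ltnW.
rewrite /run_of /= pE /= mE IH// wE lE -/(run_of x) -/low.
move: xI; rewrite lowS weightS; case: eqVneq => [->|nl] xI.
  by rewrite addr0 in xI; rewrite (andP xI).2.
have [er|nr] := eqVneq (r n.+1) (rgt (r n)).
  by rewrite er; case: (ltP x _) => // h; move: xI; rewrite leNgt h.
(* A step to a non-successor has an empty interval. *)
by move: xI; rewrite (tau_eq0 _ nl nr) mulr0 addr0 => /andP[/le_lt_trans h /h];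
  rewrite ltxx.
Qed.

(** Makes the run constant outside [0, 1[, so that a preimage of a cylinder contains all or none of
    these points; [unif01] gives them no mass. *)
Let clamp (x : R) : R := if 0 <= x < 1 then x else 0.

Let clamped_run (x : measurableTypeR R) : borel_run s0 := run_of (clamp x).

Let clamped_run_cylinder r n : r 0%N = s0 ->
  clamped_run @^-1` cylinder r n `&` `[0, 1[ =
  `[low r n, low r n + weight r n[%classic.
Proof.
move=> r0; have [b0 b1] := interval_bounds r n.
apply/seteqP; split=> x /=; rewrite !in_itv /= /clamped_run /clamp.
  by case=> + x01; rewrite x01 => /run_cylinder; exact.
move=> xI; have x01 : 0 <= x < 1 by lra.
by rewrite x01; split=> //; apply/run_cylinder.
Qed.

Let measurable_clamped_run : measurable_fun setT clamped_run.
Proof.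
apply: (@measurability _ _ _ _ setT clamped_run (@cylinders R G s0)) => //.
move=> _ [_ [r [n ->]] <-]; rewrite setTI.
have [r0|r0] := eqVneq (r 0%N) s0; last first.
  rewrite (_ : _ @^-1` _ = set0) //; apply/seteqP; split=> // x /(_ 0%N isT) E.
  by rewrite -E eqxx in r0.
rewrite -[X in measurable X](setUIDK _ `[0, 1[%classic).
apply: measurableU.
  by rewrite clamped_run_cylinder//; exact: measurable_itv.
rewrite [X in measurable X](_ : _ =
   ~` `[0, 1[ `&` (if `[<cylinder r n (run_of 0)>] then setT else set0)).
  by apply: measurableI; [apply: measurableC; exact: measurable_itv|case: ifP].
apply/seteqP; split=> x /=; rewrite in_itv /= /clamped_run /clamp.
  by move=> [+ /negP/negbTE h]; rewrite h => xC; split=> //; rewrite asboolT.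
move=> [/negP/negbTE h]; rewrite h; by case: asboolP.
Qed.

Lemma binary_game_measure_exists : exists mu : probability (borel_run s0) R,
  forall (r : nat -> G) n, r 0%N = s0 ->
    mu (cylinder r n) =
      (\prod_(i < n) tau (mkseq r i) (r i) (r i.+1))%:E.
Proof.
pose X : {mfun measurableTypeR R >-> borel_run s0} :=
  HB.pack clamped_run (isMeasurableFun.Build _ _ _ _ _ measurable_clamped_run).
exists (distribution (@unif01 R) X) => r n r0.
(* By conversion, the image measure is the Lebesgue measure of the preimage cut down to [0, 1[. *)
rewrite -[LHS]/(lebesgue_measure (clamped_run @^-1` cylinder r n `&` `[0, 1[)).
rewrite (clamped_run_cylinder n r0) lebesgue_measure_itv /= lte_fin ltrDl.
have [_|w0] := ltP 0 (weight r n); first by rewrite -EFinD addrAC subrr add0r.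
rewrite -/(weight r n) (_ : weight r n = 0)//.
by apply/le_anti; rewrite w0 weight_ge0.
Qed.

End binary_game.

(** * Measurable events and null events of plays *)

Section run_events.
Context (R : realType) (G : game R) (s0 : G).

Lemma measurable_cylinder (r : nat -> G) n :
  measurable (cylinder r n : set (borel_run s0)).
Proof. by apply: sub_sigma_algebra; exists r, n. Qed.

(** There are countably many prefixes, and fixing a nonempty one gives a cylinder or the empty
    set. *)
Lemma measurable_prefix (P : seq G -> Prop) n :
  measurable ([set r | P (mkseq r n)] : set (borel_run s0)).
Proof.
pose F (w : seq G) : set (borel_run s0) := [set r | mkseq r n = w /\ P w].
rewrite (_ : [set r | _] = \bigcup_(w : seq G) F w); last first.
  by apply/seteqP; split=> [r Pr|r [w _ [<-]]//]; exists (mkseq r n).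
apply: countable_bigcupT_measurable; first exact: countableP.
move=> w; have [[r0 [r0w Pw]]|/nonemptyPn ->] := pselect (F w !=set0);
  last first.
  exact: measurable0.
case: n => [|n] in F r0w *.
  by rewrite (_ : F w = setT) //; apply/seteqP; split=> // r _; rewrite /F -r0w.
rewrite (_ : F w = cylinder r0 n); first exact: measurable_cylinder.
apply/seteqP; split=> r.
  move=> [rw _] i ni; move: rw; rewrite -r0w => /eq_in_map; apply.
  by rewrite mem_iota.
move=> rr0; split=> //; rewrite -r0w; apply/eq_in_map => i.
by rewrite mem_iota => /andP[_]; exact: rr0.
Qed.

Lemma measurable_coordinate (A : set G) n :
  measurable ([set r | A (r n)] : set (borel_run s0)).
Proof.
rewrite (_ : [set r | _] = [set r | A (last s0 (mkseq r n.+1))]).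
  exact: (@measurable_prefix (fun w => A (last s0 w)) n.+1).
by apply/funext => r; rewrite /mkset mkseqS last_rcons.
Qed.

Lemma measurable_buchi (T : set G) :
  measurable (buchi T : set (borel_run s0)).
Proof.
rewrite (_ : buchi T = \bigcap_i \bigcup_(j in [set j | (i <= j)%N])
    [set r : borel_run s0 | T (r j)]).
  apply: bigcap_measurable => // i _; apply: bigcup_measurable => j _.
  exact: measurable_coordinate.
apply/seteqP; split=> r rT i.
  by move=> _; have [j ij Tj] := rT i; exists j.
by have [j ij Tj] := rT i I; exists j.
Qed.

Context (tau : seq G -> G -> G -> R) (mu : probability (borel_run s0) R).

(** Abstracting from [step] lets one argument serve both players. *)
Definition follows_steps := forall (r : nat -> G) n, r 0%N = s0 ->
  mu (cylinder r n) = (\prod_(i < n) tau (mkseq r i) (r i) (r i.+1))%:E.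

Hypothesis muE : follows_steps.

Lemma cylinderS_prob (r : nat -> G) n : r 0%N = s0 ->
  mu (cylinder r n.+1) =
    (mu (cylinder r n) * (tau (mkseq r n) (r n) (r n.+1))%:E)%E.
Proof. by move=> r0; rewrite !muE// big_ord_recr EFinM. Qed.

(** A vanishing step makes its prefix a null cylinder, and there are only countably many
    prefixes. *)
Lemma negligible_null_step : mu.-negligible
  [set r | r 0%N = s0 /\ exists n, tau (mkseq r n) (r n) (r n.+1) = 0].
Proof.
pose F (w : seq G) : set (borel_run s0) := [set r | exists n,
  [/\ mkseq r n.+2 = w, r 0%N = s0 & tau (mkseq r n) (r n) (r n.+1) = 0]].
have FN w : mu.-negligible (F w).
  have [[r0 [n [r0w r00 r0n]]]|/nonemptyPn ->] := pselect (F w !=set0);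
    last first.
    exact: negligible_set0.
  suff : mu.-negligible (cylinder r0 n.+1).
    apply: negligibleS => r [m [rw _ _]] i ni; have := rw; rewrite -r0w.
    have /(congr1 size) := rw; rewrite -r0w !size_mkseq => -[->] /eq_in_map.
    by apply; rewrite mem_iota.
  exists (cylinder r0 n.+1); split=> //; first exact: measurable_cylinder.
  by rewrite cylinderS_prob// r0n mule0.
suff : mu.-negligible (\bigcup_k (if unpickle k is Some w then F w else set0)).
  apply: negligibleS => r [r0 [n rn]]; exists (pickle (mkseq r n.+2)) => //.
  by rewrite pickleK; exists n.
by apply: negligible_bigcup => k; exact: FN.
Qed.

End run_events.

Lemma step_distr (R : realType) (G : game R) (sigma : strategy G Box)
    (pi : strategy G Diamond) (w : seq G) (s : G) :
  is_distr (succ s) (step sigma pi w s).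
Proof.
by rewrite /step; case E: (kind_of s); [exact: strat_distr|exact: strat_distr|
  exact: prob_distr].
Qed.

(** Existence ensures that [xget] returns a solution and not its Dirac default. *)
Lemma binary_game_measureP (R : realType) (G : game R) (lft rgt : G -> G)
    (s0 : G) (sigma : strategy G Box) (pi : strategy G Diamond) :
  (forall s : G, succ s = [set lft s; rgt s]) ->
  is_game_measure sigma pi (game_measure s0 sigma pi).
Proof.
move=> succE; apply: xgetPex.
exact: (binary_game_measure_exists succE s0 (step_distr sigma pi)).
Qed.

(** * The chain game *)

(** [chain d n] is position n on the chain of player [d], [exit d n] the random state reached by
    leaving there, and [sink b] the absorbing state in which [b] has won. *)
Inductive chain_state := start | chain of bool & nat | exit of bool & nat
  | sink of bool.

Definition chain_state_encode s : unit + bool * nat + bool * nat + bool :=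
  match s with
  | start => inl (inl (inl tt))
  | chain d n => inl (inl (inr (d, n)))
  | exit d n => inl (inr (d, n))
  | sink b => inr b
  end.

Definition chain_state_decode (x : unit + bool * nat + bool * nat + bool) :=
  match x with
  | inl (inl (inl tt)) => start
  | inl (inl (inr (d, n))) => chain d n
  | inl (inr (d, n)) => exit d n
  | inr b => sink b
  end.

Lemma chain_state_encodeK : cancel chain_state_encode chain_state_decode.
Proof. by case. Qed.

HB.instance Definition _ :=
  Countable.copy chain_state (can_type chain_state_encodeK).

Section chain_game.
Context (R : realType) (c : R) (c01 : 0 < c < 1).

(* The supremum of the winning probabilities of [d], the maximizer being [true],
   when the coin sends the play to his own chain. *)
Definition share (d : bool) : R := if d then c else 1 - c.

Definition win_prob (d : bool) n : R := share d * (1 - n.+1%:R^-1).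

Definition lft s := match s with
  | start => chain true 0
  | chain d n => exit d n
  | exit _ _ => sink true
  | sink b => sink b
  end.

Definition rgt s := match s with
  | start => chain false 0
  | chain d n => chain d n.+1
  | exit _ _ => sink false
  | sink b => sink b
  end.

Definition chain_kind s :=
  if s is chain d _ then if d then Box else Diamond else Random.

Definition chain_prob (s t : chain_state) : R := match s, t with
  | start, chain _ 0 => 2^-1
  | exit d n, sink b => if b == d then win_prob d n else 1 - win_prob d n
  | sink b, sink b' => (b == b')%:R
  | _, _ => 0
  end.

Lemma share_gt0 d : 0 < share d.
Proof. by case/andP: c01 => c0 c1; rewrite /share; case: d => /=; lra. Qed.

Lemma shareN d : share (~~ d) = 1 - share d.
Proof. by rewrite /share; case: d => /=; lra. Qed.

Lemma share_lt1 d : share d < 1.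
Proof. by have := share_gt0 (~~ d); rewrite shareN; lra. Qed.

Lemma invS01 n : 0 < (n.+1%:R^-1 : R) <= 1.
Proof. by rewrite invr_gt0 ltr0n /= invf_le1 ?ltr0n// ler1n. Qed.

Lemma win_prob01 d n : 0 <= win_prob d n <= 1.
Proof.
have := invS01 n; have := share_gt0 d; have := share_lt1 d; rewrite /win_prob.
by move: (_^-1) => x; nra.
Qed.

Let chain_succ (s : chain_state) : set chain_state := [set lft s; rgt s].

Let chain_succ_neq0 s : chain_succ s !=set0.
Proof. by exists (lft s); left. Qed.

Let chain_prob_distr s : chain_kind s = Random ->
  is_distr (chain_succ s) (chain_prob s).
Proof.
move=> ks; apply/is_distr_set2.
case: s ks => [|[]//|d n|b] _ /=; split.
- by case=> // _ [].
- by case=> // -[] [].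
- by rewrite /=; lra.
- by case=> // b; case: ifP => _; have := win_prob01 d n; lra.
- by case=> // -[].
- by case: d => /=; lra.
- by case.
- by case=> // b' /eqP h _ /=; case: eqVneq => // e; case: h; rewrite e.
- by rewrite /= ifT ?addr0//; case: b.
Qed.

Definition chain_game : game R :=
  Game chain_succ_neq0 chain_prob_distr.

Lemma chain_game_finitely_branching : finitely_branching chain_game.
Proof. by move=> s; rewrite /= /chain_succ; exact: finite_set2. Qed.

(** Off the chains it defaults to [lft], so that the choice is a successor at every state. *)
Definition leave_choice j s : chain_state :=
  if s is chain d n then if n == j then exit d n else chain d n.+1 else lft s.

Let leave_distr j (w : seq chain_game) (s : chain_game) :
  is_distr (succ s) (fun t => (t == leave_choice j s)%:R : R).
Proof.
have sl : leave_choice j s = lft s \/ leave_choice j s = rgt s.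
  by case: s => [|d n|d n|b] /=; [left|case: ifP => _; [left|right]|left|left].
apply/is_distr_set2; split=> [t|t /negbTE tl /negbTE tr|].
- by rewrite ler0n.
- by case: sl => ->; rewrite ?tl ?tr.
- case: sl => ->; rewrite eqxx.
  all: by case: (eqVneq (lft s) (rgt s)) => _; rewrite ?addr0 ?add0r.
Qed.

Definition leave_at k j : strategy chain_game k :=
  Strategy (fun w s _ => leave_distr j w s).

(** * Shape of the plays and their winners *)

(** As [start] occupies time 0, chain position k is visited at time k + 1, the exit at time n + 2,
    and the sink from time n + 3 on. *)
Definition exit_run d n b i : chain_game :=
  if i is k.+1 then
    if (k <= n)%N then chain d k else if k == n.+1 then exit d n else sink b
  else start.

Definition legal (r : nat -> chain_game) :=
  r 0%N = start /\ forall n, succ (r n) (r n.+1).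

(** The first deviation from the chain must be an exit, and the sink that follows is absorbing. *)
Lemma play_shape (r : nat -> chain_game) : legal r ->
  exists d, (forall n, r n.+1 = chain d n) \/ exists n b, r =1 exit_run d n b.
Proof.
move=> [r0 rS]; have [d r1] : exists d, r 1%N = chain d 0.
  by have := rS 0%N; rewrite r0 => -[->|->]; [exists true|exists false].
exists d.
have [?|/existsNP[m0 /eqP ne0]] := pselect (forall n, r n.+1 = chain d n).
  by left.
right; have ex : exists m, r m.+1 != chain d m by exists m0.
case: (ex_minnP ex) => -[|n]; first by rewrite r1 eqxx.
move=> ne nmin.
have rchain k : (k <= n)%N -> r k.+1 = chain d k.
  move=> kn; apply/eqP; apply/negPn/negP => /nmin; by rewrite ltnNge kn.
have rexit : r n.+2 = exit d n.
  have := rS n.+1; rewrite rchain// => -[//|E]; by rewrite E eqxx in ne.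
have [b rsink0] : exists b, r n.+3 = sink b.
  by have := rS n.+2; rewrite rexit => -[->|->]; [exists true|exists false].
have rsink k : r (n.+3 + k)%N = sink b.
  elim: k => [|k IH]; first by rewrite addn0.
  by have := rS (n.+3 + k)%N; rewrite IH -addnS => -[].
exists n, b => -[//|i] /=; case: leqP => [/rchain//|ni].
case: eqVneq => [->//|ne']; have ni3 : (n.+3 <= i.+1)%N by lia.
by rewrite -(subnKC ni3) rsink.
Qed.

Definition wins d (r : nat -> chain_game) :=
  (exists n, r n = sink d) \/ forall n, r n.+1 = chain (~~ d) n.

(** The chain of the opponent of [b] is included, so that staying on it forever counts for [b]: a
    legal play meets [goal b] infinitely often when [b] wins, and only finitely often when the
    opponent does. *)
Definition goal (b : bool) : set chain_game := [set s | match s with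
  | sink b' => b' = b
  | chain d _ => d = ~~ b
  | _ => False
  end].

Lemma buchi_goal (r : nat -> chain_game) d :
  legal r -> buchi (goal d) r -> wins d r.
Proof.
move=> rL rT; have [e [re|[n [b rp]]]] := play_shape rL.
  by have [[//|j] _] := rT 1%N; rewrite re /= => ed; right => n;
  rewrite re ed.
(* From this index on the play has passed chain and exit, so the visit is to the sink. *)
left; have [[//|j] nj] := rT n.+3; rewrite rp /=.
have -> : (j <= n)%N = false by lia.
have -> : (j == n.+1)%N = false by lia.
move=> /= bd; exists n.+3; rewrite rp /= bd.
have -> : (n.+2 <= n)%N = false by lia.
by have -> : (n.+2 == n.+1)%N = false by lia.
Qed.

Lemma cobuchi_goal (r : nat -> chain_game) d :
  legal r -> cobuchi (goal (~~ d)) r -> wins d r.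
Proof.
move=> rL rT; have [e [re|[n [b rp]]]] := play_shape rL.
  have [ed|ed] := eqVneq e (~~ d); first by right => n; rewrite re ed.
  exfalso; apply: rT => i; exists i.+1 => //; rewrite re /=.
  by move: ed; case: e {re}; case: d.
left; have rsink i : r (n.+3 + i)%N = sink b.
  rewrite rp /=.
  have -> : ((n + i).+2 <= n)%N = false by lia.
  by have -> : ((n + i).+2 == n.+1)%N = false by lia.
exists n.+3; have := rsink 0%N; rewrite addn0 => ->.
have [->//|bd] := eqVneq b d; exfalso; apply: rT => i.
exists (n.+3 + i)%N; first exact: leq_addl.
by rewrite rsink /=; move: bd; case: b {rp rsink}; case: d.
Qed.

End chain_game.

(** * The positive loss on one's own chain *)

(** The factor 1 - 1/(n+1) costs each [u n] the amount [share c d * u n / (n+1)], so a single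
    positive term already gives a gap. [delta] precedes the hypotheses on [u] because these are
    later derived from a measure depending on the opponent's reply, which is itself chosen from
    [delta]. *)
Lemma win_series_gap (R : realType) (c : R) (c01 : 0 < c < 1) d (u : nat -> R) :
  exists2 delta : R, 0 < delta & (forall n, 0 <= u n) ->
    (\sum_(n <oo) (u n)%:E <= (2^-1)%:E)%E ->
    (\sum_(n <oo) (win_prob c d n * u n)%:E <= (share c d / 2 - delta)%:E)%E.
Proof.
have p0 := share_gt0 c01 d.
have [[m um]|/forallNP uN] := pselect (exists m, 0 < u m); last first.
  exists (share c d / 2); first by rewrite divr_gt0.
  move=> u0 _; rewrite subrr eseries0// => n _ _.
  have -> : u n = 0 by apply/le_anti; rewrite u0 andbT leNgt; exact/negP.
  by rewrite mulr0.
exists (share c d * m.+1%:R^-1 * u m).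
  by rewrite !mulr_gt0// invr_gt0 ltr0n.
move=> u0 su.
have w0 n : (0 <= (win_prob c d n * u n)%:E)%E.
  by rewrite lee_fin mulr_ge0//; case/andP: (win_prob01 c01 d n).
have l0 n : (0 <= (share c d * n.+1%:R^-1 * u n)%:E)%E.
  by rewrite lee_fin !mulr_ge0// ?invr_ge0 ?ler0n// ltW.
have sumE : (\sum_(n <oo) (win_prob c d n * u n)%:E +
    \sum_(n <oo) (share c d * n.+1%:R^-1 * u n)%:E =
    (share c d)%:E * \sum_(n <oo) (u n)%:E)%E.
  rewrite -nneseriesD// -nneseriesZl//.
    apply: eq_eseriesr => n _; rewrite -EFinD -EFinM /win_prob.
    by congr EFin; ring.
  by move=> n _; rewrite lee_fin.
rewrite EFinB leeBrDr//.
apply: (@le_trans _ _ ((share c d)%:E * \sum_(n <oo) (u n)%:E)%E); last first.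
  by rewrite EFinM lee_pmul2l// lte_fin.
rewrite -sumE leeD2l// (@nneseriesD1 _ _ m) // leeDl//.
by apply: nneseries_ge0.
Qed.

(** * Winning probability against an opponent who leaves at position [j] *)

Section gap.
Context (R : realType) (c : R) (c01 : 0 < c < 1).
Local Notation G := (chain_game c01).
Context (d : bool) (g : seq G -> G -> G -> R).

(* The probability that [d] gets his chain and leaves it at position [n], in
   terms of his own strategy [g] alone: the gap must not depend on the reply. *)
Let exit_prob n := let r := exit_run c01 d n d in
  2^-1 * \prod_(i < n.+1) g (mkseq r i.+1) (r i.+1) (r i.+2).

Section fixed_opponent.
Context (j : nat) (tau : seq G -> G -> G -> R).
Hypothesis tau_distr : forall w (s : G), is_distr (succ s) (tau w s).
Hypothesis tau_random :
  forall w s, chain_kind s = Random -> tau w s = chain_prob c s.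
Hypothesis tau_own : forall w n, tau w (chain d n) = g w (chain d n).
Hypothesis tau_opp : forall w n t,
  tau w (chain (~~ d) n) t = (t == leave_choice j (chain (~~ d) n))%:R.
Context (mu : probability (borel_run (start : G)) R).
Hypothesis muE : follows_steps tau mu.

Let exited e n : set (borel_run (start : G)) :=
  cylinder (exit_run c01 e n d) n.+2.
Let won e n : set (borel_run (start : G)) := cylinder (exit_run c01 e n d) n.+3.

Let mexited e n : measurable (exited e n).
Proof. exact: measurable_cylinder. Qed.

Let mwon e n : measurable (won e n).
Proof. exact: measurable_cylinder. Qed.

Let exit_run_exit e n : exit_run c01 e n d n.+2 = exit e n.
Proof. by rewrite /= ltnn eqxx. Qed.

Let exit_run_sink e n : exit_run c01 e n d n.+3 = sink d.
Proof.
rewrite /=; have -> : (n.+2 <= n)%N = false by lia.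
by have -> : (n.+2 == n.+1)%N = false by lia.
Qed.

Let won_prob e n : mu (won e n) = (mu (exited e n) *
  (if d == e then win_prob c e n else 1 - win_prob c e n)%:E)%E.
Proof.
rewrite /won (cylinderS_prob muE)//; congr (_ * _%:E)%E.
by rewrite exit_run_exit exit_run_sink tau_random.
Qed.

Let exitedE n : mu (exited d n) = (exit_prob n)%:E.
Proof.
rewrite /exited muE// big_ord_recl; congr (_ * _)%:E.
  by rewrite tau_random.
apply: eq_bigr => i _; rewrite lift0.
have -> : exit_run c01 d n d i.+1 = chain d i by rewrite /= -ltnS ltn_ord.
by rewrite tau_own.
Qed.

(** [g] is an arbitrary function, so the sign is read off from [mu]. *)
Lemma exit_prob_ge0 n : 0 <= exit_prob n.
Proof. by rewrite -lee_fin -exitedE. Qed.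

Let side e : set (borel_run (start : G)) := cylinder (exit_run c01 e 0 d) 1.

Let side_prob e : mu (side e) = (2^-1)%:E.
Proof. by rewrite /side muE// big_ord1 tau_random. Qed.

Let exited_side e n : exited e n `<=` side e.
Proof. by move=> r rX [|[|//]] _; rewrite rX. Qed.

Let trivIset_exited e : trivIset setT (exited e).
Proof.
have lt_disj m n r : (m < n)%N -> exited e m r -> exited e n r -> False.
  move=> mn /(_ m.+2 (leqnn _)) rm /(_ m.+2); rewrite rm exit_run_exit /=.
  by rewrite mn => /(_ (ltnW mn)).
apply/trivIsetP => m n _ _ mn; apply/seteqP; split=> // r [rm rn].
case: (ltngtP m n) mn => // h _.
  exact: (lt_disj m n r).
exact: (lt_disj n m r).
Qed.

(** Exits at different positions are disjoint events within the event that the coin selects the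
    chain of [d]. *)
Lemma sum_exit_prob_le : (\sum_(n <oo) (exit_prob n)%:E <= (2^-1)%:E)%E.
Proof.
rewrite -(side_prob d) -(eq_eseriesr (fun n _ => exitedE n)).
rewrite -measure_semi_bigcup//; last exact: bigcupT_measurable.
apply: le_measure; rewrite ?inE.
- exact: bigcupT_measurable.
- exact: measurable_cylinder.
- by move=> r [n _]; exact: exited_side.
Qed.

Let bigcup_won_prob :
  mu (\bigcup_n won d n) = (\sum_(n <oo) (win_prob c d n * exit_prob n)%:E)%E.
Proof.
rewrite measure_semi_bigcup//; last exact: bigcupT_measurable.
  apply: eq_eseriesr => n _; apply: (etrans (won_prob d n)).
  by rewrite eqxx exitedE -EFinM mulrC.
have sub n : won d n `<=` exited d n by move=> r rW i ni; rewrite rW // leqW.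
have /trivIsetP disj := @trivIset_exited d.
apply/trivIsetP => m n _ _ mn; apply/seteqP; split=> // r [/sub rm /sub rn].
by rewrite -(disj m n I I mn).
Qed.

Let won_opp_prob :
  (mu (won (~~ d) j) <= (2^-1 * (1 - win_prob c (~~ d) j))%:E)%E.
Proof.
rewrite won_prob ifF ?EFinM; last by case: d.
have := win_prob01 c01 (~~ d) j => w01.
apply: lee_wpmul2r; first by rewrite lee_fin; lra.
rewrite -(side_prob (~~ d)); apply: le_measure; rewrite ?inE//.
exact: measurable_cylinder.
Qed.

Context (E : set (nat -> G)).
Hypothesis mE : measurable (E : set (borel_run (start : G))).
Hypothesis E_win : forall r : nat -> G, legal r -> E r -> wins d r.

(** With positive steps only, the opponent cannot stay on his chain past [j] nor leave it elsewhere.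
    So [d] either wins through an exit of his own or through the opponent's exit at [j]. *)
Let E_cover (r : nat -> G) : r 0%N = start -> E r ->
    (forall n, tau (mkseq r n) (r n) (r n.+1) != 0) ->
  (exists n, won d n r) \/ won (~~ d) j r.
Proof.
move=> r0 Er rpos.
have rL : legal r.
  split=> // n; apply: contrapT => h; have /eqP := rpos n; apply.
  by have [_ + _] := tau_distr (mkseq r n) (r n); exact.
have rwin := E_win rL Er.
have [e [re|[n [b rp]]]] := play_shape rL.
  have {rwin}rd k : r k.+1 = chain (~~ d) k.
    case: rwin => // -[[|m]]; first by rewrite r0.
    by rewrite re.
  have := rpos j.+1; rewrite !rd tau_opp /= eqxx.
  by case: eqVneq => //; rewrite eqxx.
have {rwin}bd : b = d.
  case: rwin => [[m]|/(_ n.+1)]; rewrite rp.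
    by case: m => //= m; case: ifP => // _; case: ifP => // _ [].
  by rewrite /= ltnn eqxx.
rewrite bd in rp; have [ed|ed] := eqVneq e d.
  by left; exists n => i _; rewrite rp ed.
have {}ed : e = ~~ d by move: ed; case: (e); case: (d).
rewrite ed in rp; right; have [nj|nj] := eqVneq n j.
  by move=> i _; rewrite rp nj.
have := rpos n.+1; rewrite (rp n.+2) exit_run_exit (rp n.+1) /= leqnn.
by rewrite tau_opp /= (negbTE nj) eqxx.
Qed.

(** Union bound over the cover from [E_cover], after discarding the null set of plays with a step of
    probability 0. *)
Lemma objective_prob_le :
  (mu (E `&` [set r | r 0%N = start]) <=
    \sum_(n <oo) (win_prob c d n * exit_prob n)%:E +
    (2^-1 * (1 - win_prob c (~~ d) j))%:E)%E.
Proof.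
have [N [mN N0 subN]] := negligible_null_step muE.
have mstart :
    measurable ([set r | r 0%N = start] : set (borel_run (start : G))).
  exact: (@measurable_coordinate R G start [set (start : G)] 0%N).
have mW : measurable (\bigcup_n won d n) by exact: bigcupT_measurable.
apply: (@le_trans _ _ (mu (N `|` (\bigcup_n won d n `|` won (~~ d) j)))).
  apply: le_measure; rewrite ?inE; first exact: measurableI.
    by apply: measurableU => //; exact: measurableU.
  move=> r [Er r0].
  have [rN|rpos] := pselect (exists n, tau (mkseq r n) (r n) (r n.+1) = 0).
    by left; exact: subN.
  right; have [n|[n rW]|rW] := E_cover r0 Er.
  - by apply/eqP => rn; apply: rpos; exists n.
  - by left; exists n.
  - by right.
have muU A B : measurable A -> measurable B -> (mu (A `|` B) <= mu A + mu B)%E.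
  exact: measureU2.
apply: (le_trans (muU _ _ mN (measurableU _ _ mW (mwon _ _)))).
rewrite (N0 : mu N = 0%E) add0e.
apply: (le_trans (muU _ _ mW (mwon _ _))).
by rewrite bigcup_won_prob leeD2l//; exact: won_opp_prob.
Qed.

End fixed_opponent.

(** The reply [j] depends on [g] alone, hence is fixed before [tau] and its measure. *)
Lemma leaving_late_beats : exists j, forall tau : seq G -> G -> G -> R,
  (forall w (s : G), is_distr (succ s) (tau w s)) ->
  (forall w s, chain_kind s = Random -> tau w s = chain_prob c s) ->
  (forall w n, tau w (chain d n) = g w (chain d n)) ->
  (forall w n t,
     tau w (chain (~~ d) n) t = (t == leave_choice j (chain (~~ d) n))%:R) ->
  forall mu : probability (borel_run (start : G)) R, follows_steps tau mu ->
  forall E : set (nat -> G), measurable (E : set (borel_run (start : G))) ->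
  (forall r : nat -> G, legal r -> E r -> wins d r) ->
  (mu (E `&` [set r | r 0%N = start]) < (share c d)%:E)%E.
Proof.
have [delta delta0 gap] := win_series_gap c01 d exit_prob.
(* This gives 1/(j+1) < [delta], while leaving at [j] costs the opponent only [(1 - share c d) / 2]
   times 1/(j+1). *)
exists (Num.truncn delta^-1) => tau tau_distr tau_random tau_own tau_opp mu muE.
move=> E mE E_win.
apply: (le_lt_trans
  (objective_prob_le tau_distr tau_random tau_own tau_opp muE mE E_win)).
apply: (@le_lt_trans _ _ ((share c d / 2 - delta)%:E +
    (2^-1 * (1 - win_prob c (~~ d) (Num.truncn delta^-1)))%:E)%E).
  rewrite leeD2r//; apply: gap.
    exact: (exit_prob_ge0 tau_random tau_own muE).
  exact: (sum_exit_prob_le tau_random tau_own muE).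
rewrite -EFinD lte_fin /win_prob shareN.
have : (Num.truncn delta^-1).+1%:R^-1 < delta.
  by rewrite invf_plt ?posrE ?ltr0n// truncnS_gt.
have := invS01 R (Num.truncn delta^-1).
have := share_gt0 c01 d; have := share_lt1 c01 d.
by move: (_.+1%:R^-1) => x; nra.
Qed.
End gap.

(** * Refutation of strong determinacy *)

(** [leaving_late_beats] is applied to [E] with [d] true and to its complement with [d] false; the
    bounds are strict, so both comparisons are refuted. *)
Lemma chain_game_not_determined (R : realType) (c : R) (c01 : 0 < c < 1)
    (E : set (nat -> chain_game c01)) (rhd : Defs.comparison) :
  measurable (E : set (borel_run (start : chain_game c01))) ->
  (forall d (r : nat -> chain_game c01),
     legal r -> (if d then E r else ~ E r) -> wins d r) ->
  ~ strongly_determined E rhd c.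
Proof.
move=> mE E_win.
have gameP := @binary_game_measureP R (chain_game c01) lft rgt start _ _
  (fun s => erefl).
case/(_ start) => [[sigma sigmaP]|[pi piP]].
- have [j jP] := @leaving_late_beats R c c01 true sigma.
  have := sigmaP (leave_at c01 Diamond j).
  suff lt : (game_prob (start : chain_game c01) sigma (leave_at c01 Diamond j) E
      < c%:E)%E.
    by case: rhd {sigmaP} => /=; [rewrite leNgt lt|rewrite ltNge (ltW lt)].
  apply: (jP (step sigma (leave_at c01 Diamond j))) => //.
  + exact: step_distr.
  + by move=> w s sR; rewrite /step /= sR.
  + exact: gameP.
  + exact: (E_win true).
- have [j jP] := @leaving_late_beats R c c01 false pi.
  apply: (piP (leave_at c01 Box j)).
  suff gt : (c%:E <
      game_prob (start : chain_game c01) (leave_at c01 Box j) pi E)%E.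
    by case: rhd {piP} => //=; exact: ltW.
  rewrite /game_prob; set mu := game_measure _ _ _.
  have muE := gameP (leave_at c01 Box j) pi.
  have : (mu (~` E `&` [set r | r 0%N = start]) < (1 - c)%:E)%E.
    apply: (jP (step (leave_at c01 Box j) pi)) => //.
    + exact: step_distr.
    + by move=> w s sR; rewrite /step /= sR.
    + exact: measurableC.
    + exact: (E_win false).
  have mS : measurable ([set r | r 0%N = start] :
      set (borel_run (start : chain_game c01))).
    exact: (@measurable_coordinate R (chain_game c01) start
      [set (start : chain_game c01)] 0%N).
  have : (mu (E `&` [set r | r 0%N = start]) +
      mu (~` E `&` [set r | r 0%N = start]) = 1)%E.
    rewrite -measureU; last first.
    - by apply/seteqP; split=> // r [[? _] []].
    - exact: (measurableI _ _ (measurableC mE)).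
    - exact: measurableI.
    rewrite -setIUl setUv setTI.
    (* The plays from [start] form a cylinder with an empty product of steps, hence of mass 1. *)
    have := muE (fun=> start) 0%N erefl; rewrite big_ord0 => <-; congr (mu _).
    apply/seteqP; split=> r /=; last exact.
    by move=> r0 i; rewrite leqn0 => /eqP ->.
  have muf A : measurable A -> mu A \is a fin_num by exact: fin_num_measure.
  have := muf _ (measurableI _ _ mE mS).
  have := muf _ (measurableI _ _ (measurableC mE) mS).
  move: (mu _) (mu _) => [x| |] [y| |] // _ _ [xy].
  by rewrite !lte_fin; lra.
Qed.

Theorem theorem3 (R : realType) (c : R) (rhd : Defs.comparison) :
  0 < c < 1 ->
  (exists (G : game R) (T : set G),
     finitely_branching G /\ ~ strongly_determined (buchi T) rhd c) /\
  (exists (G : game R) (T : set G),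
     finitely_branching G /\ ~ strongly_determined (cobuchi T) rhd c).
Proof.
move=> c01; split; exists (chain_game c01).
- exists (goal true); split; first exact: chain_game_finitely_branching.
  apply: chain_game_not_determined; first exact: measurable_buchi.
  case=> r rL; first exact: buchi_goal.
  exact: (@cobuchi_goal _ _ _ r false).
(* For co-Buchi the goals are exchanged: the maximizer wants [goal false] to be met only finitely
   often. *)
- exists (goal false); split; first exact: chain_game_finitely_branching.
  apply: chain_game_not_determined.
    by apply: measurableC; exact: measurable_buchi.
  case=> r rL; first exact: (@cobuchi_goal _ _ _ r true).
  by move=> /contrapT; exact: buchi_goal.
Qed.
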